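(* For every $n\ge 1$, the $(q,r)$-Eulerian polynomials have the interpretation $$A_n(t,r,q)=\sum_{\pi\in\mathfrak{S}_n}t^{\mathrm{des}(\pi)}\,r^{\mathrm{rix}(\pi)}\,q^{\mathrm{ai}(\pi)}.$$
   Context: Notation: $(q;q)_n=\prod_{i=1}^n(1-q^i)$, $(q;q)_0=1$; $e(z;q)=\sum_{n\ge 0}\frac{z^n}{(q;q)_n}$. The $(q,r)$-Eulerian polynomials $A_n(t,r,q)$, $n\ge 0$, are defined by the identity of formal power series in $z$ $$\sum_{n\ge 0}A_n(t,r,q)\frac{z^n}{(q;q)_n}=\frac{(1-t)e(rz;q)}{e(tz;q)-te(z;q)}.$$ $\mathfrak{S}_n$ is the set of permutations of $[n]=\{1,\dots,n\}$, written as words $\pi(1)\cdots\pi(n)$. $\mathrm{des}(\pi)$ is the number of $i$ with $1\le i\le n-1$ and $\pi(i)>\pi(i+1)$. An inversion of $\pi$ is a pair $(\pi(i),\pi(j))$ with $1\le i<j\le n$ and $\pi(i)>\pi(j)$. It is an admissible inversion if either (1) $1<i$ and $\pi(i-1)<\pi(i)$, or (2) there is some $l$ with $i<l<j$ and $\pi(i)<\pi(l)$. $\mathrm{ai}(\pi)$ is the number of admissible inversions of $\pi$. The statistic $\mathrm{rix}$ is defined recursively on words $W=w_1w_2\cdots w_n$ over $\mathbb{N}$: $\mathrm{rix}(\emptyset)=0$, and, if $w_i$ is the rightmost maximum element of $W$, $$\mathrm{rix}(W)=\begin{cases}0,&\text{if } i=1\neq n,\\ 1+\mathrm{rix}(w_1\cdots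 w_{n-1}),&\text{if } i=n,\\ \mathrm{rix}(w_{i+1}w_{i+2}\cdots w_n),&\text{if } 1<i<n.\end{cases}$$ A permutation is regarded as a word. *)

(* Defs.v *)
From HB Require Import structures.
From mathcomp Require Import all_boot all_order all_algebra all_fingroup.
From mathcomp Require Import mpoly.

Set Implicit Arguments.
Unset Strict Implicit.
Unset Printing Implicit Defensive.

Import GRing.Theory.
Local Open Scope ring_scope.

(* A formal power series in z over K is its coefficient sequence; equality of
   series is pointwise equality of sequences. *)
Definition fps (K : fieldType) : Type := nat -> K.

Definition fps_sub (K : fieldType) (f g : fps K) : fps K :=
  fun n => f n - g n.

Definition fps_scale (K : fieldType) (c : K) (f : fps K) : fps K :=
  fun n => c * f n.

Definition fps_mul (K : fieldType) (f g : fps K) : fps K :=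
  fun n => \sum_(i < n.+1) f i * g (n - i)%N.

(* The first n coefficients h_0, ..., h_(n-1) of f / g, from
   f_m = \sum_(i < m) h_i g_(m-i) + h_m g_0. *)
Fixpoint fps_div_coefs (K : fieldType) (f g : fps K) (n : nat) : seq K :=
  if n is m.+1 then
    let h := fps_div_coefs f g m in
    rcons h ((f m - \sum_(i < m) h`_i * g (m - i)%N) / g 0%N)
  else [::].

(* Meaningful when g 0 != 0: see fps_divP. *)
Definition fps_div (K : fieldType) (f g : fps K) : fps K :=
  fun n => (fps_div_coefs f g n.+1)`_n.

Lemma size_fps_div_coefs (K : fieldType) (f g : fps K) n :
  size (fps_div_coefs f g n) = n.
Proof. by elim: n => //= n IHn; rewrite size_rcons IHn. Qed.

Lemma nth_fps_div_coefs (K : fieldType) (f g : fps K) n i :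
  (i < n)%N -> (fps_div_coefs f g n)`_i = fps_div f g i.
Proof.
elim: n => // n IHn; rewrite ltnS leq_eqVlt => /orP[/eqP-> // | lt_in].
by rewrite /= nth_rcons size_fps_div_coefs lt_in IHn.
Qed.

Lemma fps_divE (K : fieldType) (f g : fps K) n :
  fps_div f g n = (f n - \sum_(i < n) fps_div f g i * g (n - i)%N) / g 0%N.
Proof.
rewrite {1}/fps_div /= nth_rcons size_fps_div_coefs ltnn eqxx.
by congr ((_ - _) / _); apply: eq_bigr => i _; rewrite nth_fps_div_coefs.
Qed.

(* fps_div f g is the unique series h with h * g = f. *)
Lemma fps_divP (K : fieldType) (f g h : fps K) :
  g 0%N != 0 -> (fps_mul h g =1 f <-> h =1 fps_div f g).
Proof.
move=> g0; split=> [hg n | hE n].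
  elim/ltn_ind: n => n IHn; rewrite fps_divE -(hg n) /fps_mul big_ord_recr /=.
  rewrite subnn (eq_bigr (fun i : 'I_n => fps_div f g i * g (n - i)%N)).
    by rewrite addrC addrK mulfK.
  by move=> i _; rewrite IHn.
rewrite /fps_mul big_ord_recr /= subnn hE fps_divE divfK //.
rewrite (eq_bigr (fun i : 'I_n => fps_div f g i * g (n - i)%N)) ?subrKC //.
by move=> i _; rewrite hE.
Qed.

(* (q;q)_n *)
Definition qpoch (K : fieldType) (q : K) (n : nat) : K :=
  \prod_(1 <= i < n.+1) (1 - q ^+ i).

(* e(c z; q), as a series in z *)
Definition qexp (K : fieldType) (q c : K) : fps K :=
  fun n => c ^+ n / qpoch q n.

(* (1 - t) e(r z; q) / (e(t z; q) - t e(z; q)) *)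
Definition qr_eulerian_gf (K : fieldType) (t r q : K) : fps K :=
  fps_div (fps_scale (1 - t) (qexp q r))
          (fps_sub (qexp q t) (fps_scale t (qexp q 1))).

(* A_n(t, r, q), as an element of K. The general K, t, r, q are meant to be
   specialized to indeterminates; see qr_eulerianP below. *)
Definition qr_eulerian (K : fieldType) (t r q : K) (n : nat) : K :=
  qpoch q n * qr_eulerian_gf t r q n.

(* Q(t, r, q), as the field of fractions of Z[t, r, q]. *)
Definition Qtrq : fieldType := {fraction {mpoly int[3]}}.

Definition Xt : Qtrq := tofrac ('X_(Ordinal (isT : 0 < 3)%N) : {mpoly int[3]}).
Definition Xr : Qtrq := tofrac ('X_(Ordinal (isT : 1 < 3)%N) : {mpoly int[3]}).
Definition Xq : Qtrq := tofrac ('X_(Ordinal (isT : 2 < 3)%N) : {mpoly int[3]}).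

Lemma Xvar_expn_neq1 (i : 'I_3) (n : nat) :
  (0 < n)%N -> (tofrac ('X_i : {mpoly int[3]}) : Qtrq) ^+ n != 1.
Proof.
move=> n_gt0; rewrite -tofracXn -tofrac1 tofrac_eq; apply/eqP.
move/(congr1 (meval (fun=> 0))); rewrite rmorphXn rmorph1 /= mevalXU.
by rewrite expr0n eqn0Ngt n_gt0.
Qed.

Lemma qpoch_Xq_neq0 (n : nat) : qpoch Xq n != 0.
Proof.
rewrite /qpoch big_nat; elim/big_ind: _ => [||i /andP[i_gt0 _]].
- exact: oner_neq0.
- by move=> x y x0 y0; rewrite mulf_neq0.
by rewrite subr_eq0 eq_sym Xvar_expn_neq1.
Qed.

(* The defining identity
   \sum_n A_n z^n / (q;q)_n * (e(t z; q) - t e(z; q)) = (1 - t) e(r z; q)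
   holds for A_n = qr_eulerian Xt Xr Xq n and determines it. *)
Lemma qr_eulerianP (A : nat -> Qtrq) :
  fps_mul (fun n => A n / qpoch Xq n)
          (fps_sub (qexp Xq Xt) (fps_scale Xt (qexp Xq 1)))
    =1 fps_scale (1 - Xt) (qexp Xq Xr)
  <-> A =1 qr_eulerian Xt Xr Xq.
Proof.
rewrite fps_divP; last first.
  rewrite /fps_sub /fps_scale /qexp /qpoch big_geq // !expr0 divr1 mulr1.
  by rewrite subr_eq0 eq_sym -[Xt]expr1 Xvar_expn_neq1.
split=> AE n.
  by rewrite /qr_eulerian /qr_eulerian_gf -AE mulrC divfK // qpoch_Xq_neq0.
by rewrite AE /qr_eulerian mulrC mulKf // qpoch_Xq_neq0.
Qed.

Local Close Scope ring_scope.

(* Letters of words are indexed from 0, so w_(i+1) is nth 0 w i. *)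

Definition des (w : seq nat) : nat :=
  #|[set i : 'I_(size w).-1 | nth 0 w i > nth 0 w i.+1]|.

(* An inversion is identified by its pair of positions, which for a word with
   distinct letters amounts to its pair of values. *)
Definition inversion (w : seq nat) (i j : nat) : bool :=
  [&& i < j, j < size w & nth 0 w i > nth 0 w j].

Definition admissible_inversion (w : seq nat) (i j : nat) : bool :=
  inversion w i j &&
  ((0 < i) && (nth 0 w i.-1 < nth 0 w i)
   || [exists l : 'I_(size w), (i < l < j) && (nth 0 w i < nth 0 w l)]).

Definition ai (w : seq nat) : nat :=
  #|[set ij : 'I_(size w) * 'I_(size w) | admissible_inversion w ij.1 ij.2]|.

(* Position of the rightmost maximum letter of a nonempty word. *)
Definition rmaxpos (w : seq nat) : nat :=
  \max_(i < size w | nth 0 w i == \max_(x <- w) x) i.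

(* The first argument is fuel, bounding the length of the word. *)
Fixpoint rix_rec (k : nat) (w : seq nat) : nat :=
  if k is k'.+1 then
    if w is [::] then 0
    else
      let i := rmaxpos w in
      if i == (size w).-1 then (rix_rec k' (take (size w).-1 w)).+1
      else if i == 0 then 0
      else rix_rec k' (drop i.+1 w)
  else 0.

Definition rix (w : seq nat) : nat := rix_rec (size w) w.

Lemma rix_rec_fuel k w : size w <= k -> rix_rec k w = rix w.
Proof.
suff H m : forall l v, size v <= m -> size v <= l -> rix_rec m v = rix_rec l v.
  by move=> le_wk; apply: H.
elim: m => [|m IHm] [|l] [|x v] //= le_vm le_vl.
case: ifP => _; first by congr _.+1; apply: IHm; rewrite size_take ltnSn.
by case: ifP => // _; apply: IHm; rewrite size_drop; apply: leq_trans (leq_subr _ _) _.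
Qed.

Lemma rix_nil : rix [::] = 0.
Proof. by []. Qed.

(* The defining recursion of rix. *)
Lemma rixE w : 0 < size w ->
  rix w = if rmaxpos w == (size w).-1 then 1 + rix (take (size w).-1 w)
          else if rmaxpos w == 0 then 0
          else rix (drop (rmaxpos w).+1 w).
Proof.
case: w => // x v _; rewrite {1}/rix /=.
case: ifP => _; first by rewrite add1n rix_rec_fuel // size_take /= ltnSn.
by case: ifP => // _; rewrite rix_rec_fuel // size_drop leq_subr.
Qed.

(* The word pi(1) ... pi(n) in the letters 1, ..., n. *)
Definition word (n : nat) (pi : 'S_n) : seq nat :=
  [seq (pi i).+1 | i <- enum 'I_n].

(* Main.v *)
Require Import Defs.
From mathcomp Require Import all_boot all_order all_algebra all_fingroup.
From mathcomp Require Import mpoly.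
From mathcomp Require Import ring zify.

(** Both sides satisfy the same recursion, obtained on one side by cutting a
    permutation at its largest letter and on the other side by comparing the
    generating function at z and at q z.

    Cut a word with distinct letters as u x v, where x is its largest letter.
    There is one descent at x exactly when v is nonempty.  Every inversion
    between u and v is admissible, because x lies in between and exceeds both
    letters; the |v| inversions starting at x are admissible exactly when u is
    nonempty; and the inversions within u or within v keep their status.  Thus
    des and ai split additively up to the term |v| and the number inv(u, v) of
    cross inversions, and rix becomes 1 + rix u, 0 or rix v according to
    whether v, or else u, is empty (des_max_split, ai_max_split,
    rix_max_split, combined in weight_max_split).  If m letters remain besides
    x, the cross inversions, summed over the ways to distribute them between u
    and v with |u| = k, yield the q-binomial coefficient [m, k]
    (sum_splits).  Writing S_n(r) for the sum over the permutations of n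
    letters, this gives

      S_(m+1)(r) = r S_m(r) + t sum_(1 <= k <= m) q^(m-k) [m, k] S_k(1) S_(m-k)(r),

    where the term k = m stands for the words that begin with their largest
    letter: for those rix is 0, which produces S_m(1).

    For the generating function let F_r(z) = (1-t) e(rz) / D(z) with
    D(z) = e(tz) - t e(z).  Since e(cqz) = (1 - cz) e(cz), one gets
    F_r(qz) D(qz) = (1 - rz) F_r(z) D(z) and
    D(qz) = D(z) - tz (e(tz) - e(z)) = (1 + tz (F_1(z) - 1)) D(z), hence

      F_r(qz) (1 + tz (F_1(z) - 1)) = (1 - rz) F_r(z),

    whose coefficient at z^(m+1) is the recursion above divided by (q;q)_m
    (qr_eulerian_gf_rec).

    The letters of u and v are not the initial integers.  Instead of
    standardizing words, the induction (sum_weight_permutations) is over all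
    finite sets of letters, and shows that the sum depends on their number
    only. *)

Set Implicit Arguments.
Unset Strict Implicit.
Unset Printing Implicit Defensive.

Import GRing.Theory.

(** * Cross inversions, and the statistics as sums *)

Definition cross_inv (u v : seq nat) : nat :=
  \sum_(a <- u) \sum_(b <- v) (b < a).

Lemma perm_cross_inv u u' v v' :
  perm_eq u u' -> perm_eq v v' -> cross_inv u v = cross_inv u' v'.
Proof.
move=> uu' vv'; rewrite /cross_inv (perm_big _ uu') /=.
by apply: eq_bigr => a _; apply: perm_big.
Qed.

Lemma cross_inv_nill v : cross_inv [::] v = 0.
Proof. by rewrite /cross_inv big_nil. Qed.

Lemma cross_inv_nilr u : cross_inv u [::] = 0.
Proof. by rewrite /cross_inv big1 // => a _; rewrite big_nil. Qed.

Lemma cross_inv_consl x u v : all (fun y => y < x) v ->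
  cross_inv (x :: u) v = size v + cross_inv u v.
Proof.
move=> v_lt; rewrite /cross_inv big_cons; congr (_ + _).
rewrite (eq_big_seq (fun=> 1)) ?sum1_size // => b bv.
by rewrite (allP v_lt).
Qed.

Lemma cross_inv_consr x u v : all (fun y => y < x) u ->
  cross_inv u (x :: v) = cross_inv u v.
Proof.
move=> u_lt; apply: eq_big_seq => a au; rewrite big_cons.
by rewrite ltnNge ltnW ?(allP u_lt).
Qed.

Lemma des_sum w :
  des w = \sum_(i < (size w).-1) (nth 0 w i.+1 < nth 0 w i).
Proof. by rewrite /des -sum1dep_card big_mkcond. Qed.

Lemma des_cons2 a b w : des [:: a, b & w] = (b < a) + des (b :: w).
Proof. by rewrite !des_sum /= big_ord_recl. Qed.

Lemma ai_sum w :
  ai w = \sum_(i < size w) \sum_(j < size w) admissible_inversion w i j.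
Proof.
rewrite /ai -sum1dep_card big_mkcond pair_bigA /=.
by apply: eq_bigr => -[i j] _ /=; case: ifP.
Qed.

(** * Cutting a word at its largest letter *)

Section MaxSplit.
Variables (u v : seq nat) (x : nat).
Hypotheses (u_lt : all (fun y => y < x) u) (v_lt : all (fun y => y < x) v).
Let w := u ++ x :: v.

Let nth_u i : i < size u -> nth 0 u i < x.
Proof. by move/(all_nthP 0): u_lt => /(_ i). Qed.

Let nth_v i : i < size v -> nth 0 v i < x.
Proof. by move/(all_nthP 0): v_lt => /(_ i). Qed.

Let size_w : size w = size u + (size v).+1.
Proof. by rewrite size_cat. Qed.

Let nth_wl i : i < size u -> nth 0 w i = nth 0 u i.
Proof. by move=> lt_iu; rewrite nth_cat lt_iu. Qed.

Let nth_wm : nth 0 w (size u) = x.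
Proof. by rewrite nth_cat ltnn subnn. Qed.

Let nth_wr i : nth 0 w ((size u).+1 + i) = nth 0 v i.
Proof. by rewrite nth_cat ltnNge (leq_trans (leqnSn _)) ?leq_addr //= addSnnS addKn. Qed.

(** The last letter of u is below x, so only the step from x into v can add a
    descent. *)
Lemma des_max_split : des w = des u + (0 < size v) + des v.
Proof.
rewrite /w; move: u_lt; elim: (u) => [_|a [|b u'] IHu] /=.
- case: v v_lt => [_|b v' /= /andP[bx _]]; first by rewrite !des_sum /= !big_ord0.
  by rewrite des_cons2 bx [des [::]]des_sum big_ord0.
- by rewrite andbT => ax; rewrite des_cons2 ltnNge (ltnW ax) IHu // !des_sum !big_ord0.
by case/andP=> _ /IHu; rewrite !des_cons2 => ->; rewrite !addnA.
Qed.

Lemma rmaxpos_max_split : rmaxpos w = size u.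
Proof.
have max_w : \max_(y <- w) y = x.
  apply/eqP; rewrite eqn_leq; apply/andP; split.
    apply/bigmax_leqP_seq => y; rewrite mem_cat inE => + _.
    by case/or3P=> [/(allP u_lt)|/eqP->|/(allP v_lt)] // /ltnW.
  by apply: (bigmaxn_sup_seq x); rewrite ?mem_cat ?mem_head ?orbT.
have lt_uw : size u < size w by rewrite size_w; lia.
rewrite /rmaxpos max_w (big_pred1 (Ordinal lt_uw)) // => i /=.
rewrite -val_eqE /=; case: (ltngtP i (size u)) => [lt_iu|lt_ui|->].
- by rewrite nth_wl // ltn_eqF ?nth_u.
- have lt_iw : i < size u + (size v).+1 by rewrite -size_w.
  by rewrite -(subnKC lt_ui) nth_wr ltn_eqF ?nth_v //; lia.
by rewrite nth_wm eqxx.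
Qed.

Lemma rix_max_split :
  rix w = if v == [::] then (rix u).+1 else if u == [::] then 0 else rix v.
Proof.
rewrite rixE ?rmaxpos_max_split ?size_w; last by rewrite addnS.
rewrite addnS /= -{1}[size u]addn0 eqn_add2l [0 == _]eq_sym size_eq0.
rewrite size_eq0; case: eqP => [v0|_].
  by rewrite /w v0 addn0 take_size_cat.
by case: eqP => // _; rewrite /w -cat_rcons drop_size_cat // size_rcons.
Qed.

Let sum_w (F : nat -> nat) : \sum_(i < size w) F i =
  \sum_(i < size u) F i + (F (size u) + \sum_(i < size v) F ((size u).+1 + i)).
Proof.
rewrite size_w big_split_ord /= big_ord_recl /= addn0; congr (_ + (_ + _)).
by apply: eq_bigr => i _; rewrite /bump /= add1n addSnnS.
Qed.

(** A pair within u or within v keeps its witnesses: those of condition (2) lie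
    between the two positions, and the predecessor of the first letter of v is
    now x, which does not satisfy condition (1). *)
Let adm_uu i j : i < size u -> j < size u ->
  admissible_inversion w i j = admissible_inversion u i j.
Proof.
move=> iu ju; have jw : j < size w by rewrite size_w ltn_addr.
rewrite /admissible_inversion /inversion ju jw.
rewrite !nth_wl ?(leq_ltn_trans (leq_pred i)) //.
congr (_ && (_ || _)); apply/existsP/existsP => -[l /andP[/andP[il lj] ul]].
  have lu := ltn_trans lj ju.
  by exists (Ordinal lu); rewrite /= il lj -(nth_wl lu).
have lw : l < size w by rewrite size_w ltn_addr.
by exists (Ordinal lw); rewrite /= il lj nth_wl.
Qed.

Let adm_vv i j : i < size v -> j < size v ->
  admissible_inversion w ((size u).+1 + i) ((size u).+1 + j) =
    admissible_inversion v i j.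
Proof.
move=> iv jv; have jw : (size u).+1 + j < size w by rewrite size_w; lia.
rewrite /admissible_inversion /inversion jv jw !nth_wr ltn_add2l; congr (_ && (_ || _)).
  case: i iv => [|i] iv; last by rewrite addnS [_.-1]/= !nth_wr.
  by rewrite addn0 /= nth_wm ltnNge ltnW ?nth_v.
apply/existsP/existsP => -[l /andP[/andP[il lj] ul]].
  have lv : l - (size u).+1 < size v by lia.
  exists (Ordinal lv) => /=; move: ul; rewrite -{1}(@subnKC (size u).+1 l) ?nth_wr; last lia.
  by move=> ->; lia.
have lw : (size u).+1 + l < size w by rewrite size_w addSnnS ltn_add2l ltnS.
by exists (Ordinal lw); rewrite /= nth_wr ul !ltn_add2l il lj.
Qed.

(** The letter x is a witness for condition (2). *)
Let adm_uv i j : i < size u -> j < size v ->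
  admissible_inversion w i ((size u).+1 + j) = (nth 0 v j < nth 0 u i).
Proof.
move=> iu jv; rewrite /admissible_inversion /inversion (nth_wl iu) nth_wr.
have -> : i < (size u).+1 + j by lia.
have -> : (size u).+1 + j < size w by rewrite size_w; lia.
rewrite /=; case: ltnP => //= _.
have uw : size u < size w by rewrite size_w; lia.
by apply/orP; right; apply/existsP; exists (Ordinal uw); rewrite /= nth_wm nth_u //; lia.
Qed.

Let adm_um i : i < size u -> admissible_inversion w i (size u) = false.
Proof.
move=> iu; apply/negbTE/negP => /andP[/and3P[_ _]].
by rewrite nth_wm nth_wl // ltnNge ltnW ?nth_u.
Qed.

(** No letter exceeds x, so only condition (1) can make a pair starting at x
    admissible, and it does as soon as x has a predecessor. *)
Let adm_mv j : j < size v ->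
  admissible_inversion w (size u) ((size u).+1 + j) = (0 < size u).
Proof.
move=> jv; rewrite /admissible_inversion /inversion nth_wm nth_wr nth_v //.
have -> : size u < (size u).+1 + j by lia.
have -> : (size u).+1 + j < size w by rewrite size_w; lia.
have [u0|u0] /= := posnP; last by rewrite nth_wl ?nth_u // prednK.
apply/negbTE/existsP => -[l /andP[/andP[ul lj]]].
rewrite -(subnKC ul) nth_wr ltnNge ltnW // nth_v //; lia.
Qed.

Let adm_ge i j : j <= i -> admissible_inversion w i j = false.
Proof. by rewrite /admissible_inversion /inversion ltnNge => ->. Qed.

Lemma ai_max_split :
  ai w = ai u + ai v + (0 < size u) * size v + cross_inv u v.
Proof.
have Eu : \sum_(i < size u) \sum_(j < size w) admissible_inversion w i j
    = ai u + cross_inv u v.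
  rewrite ai_sum /cross_inv (big_nth 0) big_mkord -big_split /=.
  apply: eq_bigr => i _; rewrite (sum_w (admissible_inversion w i)) adm_um // add0n; congr (_ + _).
    by apply: eq_bigr => j _; rewrite adm_uu.
  by rewrite (big_nth 0) big_mkord; apply: eq_bigr => j _; rewrite adm_uv.
have Em : \sum_(j < size w) admissible_inversion w (size u) j
    = (0 < size u) * size v.
  rewrite (sum_w (admissible_inversion w (size u))) adm_ge // add0n big1 ?add0n => [|i _]; last first.
    by rewrite adm_ge // ltnW.
  by rewrite (eq_bigr _ (fun j _ => congr1 _ (adm_mv (ltn_ord j)))) sum_nat_const card_ord mulnC.
have Ev : \sum_(i < size v) \sum_(j < size w)
    admissible_inversion w ((size u).+1 + i) j = ai v.
  rewrite ai_sum; apply: eq_bigr => i _.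
  rewrite (sum_w (admissible_inversion w ((size u).+1 + i))) adm_ge; last first.
    by rewrite leqW ?leq_addr.
  rewrite add0n big1 ?add0n => [|j _]; first by apply: eq_bigr => j _; rewrite adm_vv.
  by rewrite adm_ge // (leq_trans (ltnW (ltn_ord j))) // leqW ?leq_addr.
rewrite ai_sum (sum_w (fun i => \sum_(j < size w) admissible_inversion w i j)) Eu Em Ev; ring.
Qed.
End MaxSplit.

(** * Distributing the remaining letters on both sides of the largest one *)

(** Both components list their letters in the order of s; this makes each
    distribution occur once and keeps the components sorted when s is. *)
Fixpoint splits (s : seq nat) : seq (seq nat * seq nat) :=
  if s is x :: s' then
    [seq (x :: p.1, p.2) | p <- splits s'] ++ [seq (p.1, x :: p.2) | p <- splits s']
  else [:: ([::], [::])].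

Lemma splitsP s p : p \in splits s ->
  [/\ subseq p.1 s, subseq p.2 s & perm_eq (p.1 ++ p.2) s].
Proof.
have sub_cons a x s' : subseq a s' -> subseq a (x :: s').
  by move/subseq_trans; apply; apply: subseq_cons.
elim: s p => [|x s IHs] p /=; first by rewrite inE => /eqP->.
rewrite mem_cat => /orP[] /mapP[p' /IHs[sub1 sub2 eq_p] ->]; split.
- by rewrite /= eqxx.
- exact: sub_cons.
- by rewrite /= perm_cons.
- exact: sub_cons.
- by rewrite /= eqxx.
by rewrite /= -(cat1s x) perm_catCA perm_cons.
Qed.

Lemma filter_mem_splits (a : pred nat) s :
  ([seq x <- s | a x], [seq x <- s | ~~ a x]) \in splits s.
Proof.
elim: s => //= x s IHs; rewrite mem_cat.
by case: (a x); apply/orP; [left | right]; apply/mapP; exists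
   ([seq x <- s | a x], [seq x <- s | ~~ a x]).
Qed.

Lemma uniq_splits s : uniq s -> uniq (splits s).
Proof.
elim: s => //= x s IHs /andP[xs us]; rewrite cat_uniq !map_inj_uniq ?IHs //=.
- rewrite andbT; apply/hasPn => _ /mapP[p /splitsP[sub _ _] ->] /=.
  apply/mapP => -[p' _ [E _]]; case/negP: xs.
  by apply: (mem_subseq sub); rewrite E mem_head.
- by move=> [a b] [c d] /= [-> ->].
by move=> [a b] [c d] /= [-> ->].
Qed.

(** A word u x v determines its cut, since x occurs once in it, and then the
    distribution of the other letters, which is recovered by filtering s. *)
Lemma perm_permutations_max x s : uniq (x :: s) ->
  perm_eq (permutations (x :: s))
    [seq uv.1 ++ x :: uv.2 | p <- splits s,
       uv <- [seq (u, v) | u <- permutations p.1, v <- permutations p.2]].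
Proof.
move=> uxs; have /andP[xs us] := uxs; apply: uniq_perm.
- exact: permutations_uniq.
- apply: allpairs_uniq_dep; first exact: uniq_splits.
    by move=> p _; apply: allpairs_uniq; rewrite ?permutations_uniq // => -[? ?] [].
  move=> a b /allpairsPdep[p [uv [ps /allpairsP[[u v] [/= pu pv ->]] ->]]].
  move=> /allpairsPdep[p' [uv' [ps' /allpairsP[[u' v'] [/= pu' pv' ->]] ->]]] /= E.
  rewrite !mem_permutations in pu pv pu' pv'.
  have [s1 s2 _] := splitsP ps; have [s1' s2' _] := splitsP ps'.
  have xu : x \notin u by rewrite (perm_mem pu); apply: contra xs; apply: mem_subseq.
  have xu' : x \notin u' by rewrite (perm_mem pu'); apply: contra xs; apply: mem_subseq.
  have Eu : u = u'.
    have := congr1 (fun w => take (index x w) w) E.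
    by rewrite /= !index_cat (negPf xu) (negPf xu') /= eqxx !addn0 !take_size_cat.
  rewrite -Eu in E pu' *; move/eqP: E; rewrite eqseq_cat // eqxx eqseq_cons eqxx /=.
  move=> /eqP Ev; rewrite -Ev in pv' *.
  suff -> : p = p' by [].
  rewrite (surjective_pairing p) (surjective_pairing p').
  rewrite (subseq_uniqP us s1) (subseq_uniqP us s1').
  rewrite (subseq_uniqP us s2) (subseq_uniqP us s2').
  congr (_, _); apply: eq_filter => y.
    by rewrite -(perm_mem pu) -(perm_mem pu').
  by rewrite -(perm_mem pv) -(perm_mem pv').
move=> w; rewrite mem_permutations; apply/idP/allpairsPdep => [w_perm | ].
  have xw : x \in w by rewrite (perm_mem w_perm) mem_head.
  case/splitPr: xw w_perm => u v; rewrite -cat1s perm_catCA perm_cons => uv_perm.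
  have : uniq (u ++ v) by rewrite (perm_uniq uv_perm).
  rewrite cat_uniq => /and3P[uu /hasPn uv_dis uv_v].
  exists ([seq y <- s | y \in u], [seq y <- s | y \notin u]), (u, v).
  split=> //; first exact: (filter_mem_splits (mem u)).
  apply/allpairsP; exists (u, v); rewrite !mem_permutations; split=> //.
    apply: uniq_perm; rewrite ?filter_uniq // => y.
    by rewrite mem_filter -(perm_mem uv_perm) mem_cat andb_orr andbb; case: (y \in u).
  apply: uniq_perm; rewrite ?filter_uniq // => y.
  rewrite mem_filter -(perm_mem uv_perm) mem_cat.
  by have := uv_dis y; case: (y \in u) => //; case: (y \in v) => // /(_ isT).
case=> p [uv [/splitsP[_ _ ps] /allpairsP[[u v] [/= pu pv ->]] ->]] /=.
rewrite !mem_permutations in pu pv.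
by rewrite -cat1s perm_catCA perm_cons (perm_trans (perm_cat pu pv)).
Qed.

(** The letters are listed in decreasing order, as the induction on sorted
    lists of letters removes the largest one first. *)
Lemma perm_word_permutations n :
  perm_eq [seq word pi | pi <- enum 'S_n] (permutations (rev (iota 1 n))).
Proof.
have word_inj : injective (@word n).
  move=> pi pi' /eq_in_map E; apply/permP => i.
  by apply: val_inj; have [] := E i (mem_enum _ _).
have word_perm (pi : 'S_n) : word pi \in permutations (rev (iota 1 n)).
  rewrite mem_permutations perm_sym perm_rev -[1]addn0 iotaDl -val_enum_ord -map_comp.
  rewrite /word (map_comp (S \o val) pi) perm_map // uniq_perm ?enum_uniq //.
    by rewrite map_inj_uniq ?enum_uniq //; apply: perm_inj.
  by move=> i; rewrite mem_enum; apply/esym/mapP; exists (pi^-1%g i);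
    rewrite ?mem_enum ?permKV.
have words_uniq : uniq [seq word pi | pi <- enum 'S_n].
  by rewrite map_inj_uniq ?enum_uniq.
have words_sub : {subset [seq word pi | pi <- enum 'S_n]
    <= permutations (rev (iota 1 n))} by move=> _ /mapP[pi _ ->].
apply: uniq_perm; rewrite ?permutations_uniq //.
(* Both lists have n! elements. *)
apply: (uniq_min_size words_uniq words_sub _).2.
by rewrite size_permutations ?rev_uniq ?iota_uniq // size_rev size_iota size_map -cardE card_Sn.
Qed.

(** * The recursion satisfied by the generating function *)

Local Open Scope ring_scope.

(** Identities between power series are proved for their truncations, as
    congruences of polynomials modulo a power of the variable. *)
Lemma dvdXnP (K : fieldType) (n : nat) (p : {poly K}) :
  reflect (forall i, (i < n)%N -> p`_i = 0) ('X^n %| p).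
Proof.
apply: (iffP idP) => [/dvdpP[d ->] i lt_in | p0]; first by rewrite coefMXn lt_in.
rewrite -(poly_take_drop n p) dvdp_addl ?dvdp_mulIr //.
suff ->: take_poly n p = 0 by [].
by apply/polyP=> i; rewrite coef_take_poly coef0; case: ifP => [/p0|].
Qed.

Lemma coef_comp_scaleX (K : fieldType) (p : {poly K}) (c : K) i :
  (p \Po (c *: 'X))`_i = c ^+ i * p`_i.
Proof.
rewrite comp_polyE (eq_bigr (fun j : 'I_(size p) => (p`_j * c ^+ j) *: 'X^j)).
  rewrite -(poly_def _ (fun j => p`_j * c ^+ j)) coef_poly; case: ltnP => [_|le_pi]; first exact: mulrC.
  by rewrite nth_default // mulr0.
by move=> j _; rewrite exprZn scalerA.
Qed.

Section EulerianGF.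
Variables (K : fieldType) (t q : K).
Hypotheses (t1 : t != 1) (q_reg : forall n, qpoch q n != 0).

Let den := fps_sub (qexp q t) (fps_scale t (qexp q 1)).

Lemma qpoch0 : qpoch q 0 = 1.
Proof. by rewrite /qpoch big_geq. Qed.

Lemma qpochS n : qpoch q n.+1 = qpoch q n * (1 - q ^+ n.+1).
Proof. by rewrite /qpoch big_nat_recr. Qed.

Lemma subr_qX_neq0 n : 1 - q ^+ n.+1 != 0.
Proof. by have := q_reg n.+1; rewrite qpochS mulf_eq0 negb_or => /andP[]. Qed.

Lemma qexp0 c : qexp q c 0 = 1.
Proof. by rewrite /qexp expr0 qpoch0 divr1. Qed.

(** The coefficient form of e(cqz) = (1 - cz) e(cz). *)
Lemma qexpS c n : q ^+ n.+1 * qexp q c n.+1 = qexp q c n.+1 - c * qexp q c n.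
Proof.
rewrite /qexp qpochS [c ^+ _]exprS; have := subr_qX_neq0 n; have := q_reg n.
by move: (q ^+ _) => Q q0 Q0; field; apply/andP.
Qed.

Let den0 : den 0 != 0.
Proof. by rewrite /den /fps_sub /fps_scale !qexp0 mulr1 subr_eq0 eq_sym. Qed.

Lemma qr_eulerian_gf0 r : qr_eulerian_gf t r q 0 = 1.
Proof.
rewrite /qr_eulerian_gf fps_divE big_ord0 subr0 -/den /fps_scale qexp0 mulr1.
by rewrite /den /fps_sub /fps_scale !qexp0 mulr1 divff // subr_eq0 eq_sym.
Qed.

Section Truncation.
Variable m : nat.
Let N := m.+1.
Let trunc (f : fps K) : {poly K} := \poly_(i < N) f i.
Let E c := trunc (qexp q c).
Let dil (p : {poly K}) := p \Po (q *: 'X).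
Let D := E t - t *: E 1.

Lemma truncD : D = trunc den.
Proof.
apply/polyP=> i; rewrite coefB coefZ !coef_poly /den /fps_sub /fps_scale.
by case: ifP => // _; rewrite mulr0 subr0.
Qed.

Lemma dvd_qexp_dil c : 'X^N %| dil (E c) - (1 - c *: 'X) * E c.
Proof.
apply/dvdXnP=> i lt_iN.
rewrite mulrBl mul1r -scalerAl !coefB coefZ coefXM coef_comp_scaleX !coef_poly lt_iN.
case: i lt_iN => [|i] lt_iN; first by rewrite /= !qexp0 mulr0 subr0 mul1r subrr.
by rewrite /= (ltnW lt_iN) qexpS subrr.
Qed.

Lemma dvd_gf_den r : 'X^N %| trunc (qr_eulerian_gf t r q) * D - (1 - t) *: E r.
Proof.
apply/dvdXnP=> i lt_iN; rewrite truncD coefB coefM coefZ !coef_poly lt_iN.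
have [_ /(_ (frefl _) i)] := fps_divP (fps_scale (1 - t) (qexp q r))
  (qr_eulerian_gf t r q) den0.
rewrite /fps_scale => <-.
apply/eqP; rewrite subr_eq0; apply/eqP/eq_bigr => j _; rewrite !coef_poly.
by rewrite (leq_ltn_trans (leq_ord j)) ?(leq_ltn_trans (leq_subr _ _)).
Qed.

Lemma dvd_dil p : 'X^N %| p -> 'X^N %| dil p.
Proof.
by move=> /dvdXnP p0; apply/dvdXnP => i /p0; rewrite coef_comp_scaleX => ->; rewrite mulr0.
Qed.

(** The identity F_r(qz) (1 + tz (F_1(z) - 1)) = (1 - rz) F_r(z).  It is
    checked after multiplication by D(z), which is invertible modulo a power of
    z because D(0) = 1 - t is not 0. *)
Lemma dvd_gf_qdiff r (F := trunc (qr_eulerian_gf t r q))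
    (B := trunc (qr_eulerian_gf t 1 q)) :
  'X^N %| dil F * (1 + t *: 'X * (B - 1)) - (1 - r *: 'X) * F.
Proof.
have cop : coprimep 'X^N D.
  rewrite coprimep_expl // coprimep_sym coprimepX truncD.
  by rewrite /root horner_coef0 coef_poly.
rewrite -(Gauss_dvdpl _ cop).
(* a and b are the errors in F_r D = (1 - t) e(rz) and F_1 D = (1 - t) e(z),
   and d c is the error in e(cqz) = (1 - cz) e(cz). *)
set a := F * D - (1 - t) *: E r; set b := B * D - (1 - t) *: E 1.
have dvd_a : 'X^N %| a := dvd_gf_den r.
have dvd_b : 'X^N %| b := dvd_gf_den 1.
set d := fun c => dil (E c) - (1 - c *: 'X) * E c.
have dvd_d c : 'X^N %| d c := dvd_qexp_dil c.
have Ea : dil a = dil F * (dil (E t) - t *: dil (E 1)) - (1 - t) *: dil (E r).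
  by rewrite /dil /a rmorphB rmorphM /= comp_polyZ /D rmorphB /= comp_polyZ.
suff -> : (dil F * (1 + t *: 'X * (B - 1)) - (1 - r *: 'X) * F) * D =
  dil F * (t *: 'X * b - (d t - t%:P * d 1)) + dil a - (1 - r *: 'X) * a
   + (1 - t)%:P * d r.
  apply: dvdp_add; last exact: dvdp_mull.
  apply: dvdp_sub; last exact: dvdp_mull.
  apply: dvdp_add; last exact: dvd_dil.
  by apply/dvdp_mull/dvdp_sub; [exact: dvdp_mull | apply/dvdp_sub/dvdp_mull].
rewrite Ea /a /b /d /D -!mul_polyC !rmorphB /= !rmorph1; ring.
Qed.
End Truncation.

(** The coefficient of z^(m+1) in the preceding identity.  The sum starts at 1
    because F_1(z) - 1 has no constant term. *)
Lemma qr_eulerian_gf_rec r m (s := qr_eulerian_gf t r q) (b := qr_eulerian_gf t 1 q) :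
  (1 - q ^+ m.+1) * s m.+1 =
    r * s m + t * \sum_(1 <= k < m.+1) b k * (q ^+ (m - k) * s (m - k)%N).
Proof.
have /dvdXnP/(_ m.+1 (leqnn _)) := dvd_gf_qdiff m.+1 r.
rewrite mulrDr mulr1 mulrBl mul1r mulrCA !coefB coefD -!scalerAl !coefZ !coefXM /=.
rewrite -/s -/b [_ * (_ - 1)]mulrC coefM big_ord_recl coefB coef1 !coef_comp_scaleX.
rewrite !coef_poly ltnSn leqnSn /= [b 0%N]qr_eulerian_gf0 subrr mul0r add0r.
rewrite (eq_bigr (fun i : 'I_m => b i.+1 * (q ^+ (m - i.+1) * s (m - i.+1)%N))).
  rewrite big_add1 big_mkord => /eqP.
  rewrite subr_eq0 eq_sym subr_eq => /eqP Es.
  by rewrite mulrBl mul1r {1}Es; ring.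
move=> i _; have lt_im := ltn_ord i.
rewrite coef_comp_scaleX coefB coef1 subr0 !coef_poly ltnS.
by rewrite (leq_trans lt_im) //  ltnS leqW ?leq_subr.
Qed.
End EulerianGF.

(** * Summing over permutations *)

Definition weight (K : fieldType) (t q r : K) (w : seq nat) : K :=
  t ^+ des w * r ^+ rix w * q ^+ ai w.

Lemma weight_nil (K : fieldType) (t q r : K) : weight t q r [::] = 1.
Proof. by rewrite /weight des_sum ai_sum !big_ord0 !expr0 !mul1r. Qed.

Section Weights.
Variables (K : fieldType) (t q : K).
Hypotheses (t1 : t != 1) (q_reg : forall n, qpoch q n != 0).

(** The exponents of r depend on which side is empty; letting the parameter r
    of each factor vary, with value 1 where rix is not to be counted, covers
    all cases by a single product. *)
Lemma weight_max_split r u v x :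
    all (fun y => y < x)%N u -> all (fun y => y < x)%N v ->
  weight t q r (u ++ x :: v) = q ^+ cross_inv u v *
    (if size v == 0%N then r else t * q ^+ ((0 < size u) * size v)) *
    (weight t q (if size v == 0%N then r else 1) u *
     weight t q (if size u == 0%N then 1 else r) v).
Proof.
move=> u_lt v_lt; rewrite {1}/weight des_max_split // rix_max_split // ai_max_split //.
rewrite -!size_eq0; case: v v_lt => [|b v] v_lt /=.
  rewrite weight_nil cross_inv_nilr muln0 /weight.
  by rewrite [des [::]]des_sum [ai [::]]ai_sum !big_ord0 !addn0 exprS; ring.
case: u u_lt => [|a u] u_lt /=.
  rewrite weight_nil cross_inv_nill /weight.
  by rewrite [des [::]]des_sum [ai [::]]ai_sum !big_ord0 !addn0 !expr1n !exprD; ring.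
by rewrite /weight expr1n !exprD; ring.
Qed.

(** The sum over the distributions with fixed sizes is a q-binomial
    coefficient.  Removing the largest letter gives the q-Pascal rule: that letter
    contributes |p.2| cross inversions if it goes to the left and none if it
    goes to the right. *)
Lemma sum_splits s (G : nat -> nat -> K) : sorted gtn s ->
  \sum_(p <- splits s) q ^+ cross_inv p.1 p.2 * G (size p.1) (size p.2) =
  qpoch q (size s) * \sum_(k < (size s).+1)
    G k (size s - k)%N / (qpoch q k * qpoch q (size s - k)).
Proof.
elim: s G => [|x s IHs] G s_gt.
  by rewrite big_seq1 big_ord1 cross_inv_nill qpoch0 !mul1r divr1.
have s_lt : all (fun y => y < x)%N s by apply: order_path_min s_gt => a b c; lia.
rewrite /= big_cat !big_map /= -big_split /=.
pose H k l := q ^+ l * G k.+1 l + G k l.+1.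
rewrite (eq_big_seq (fun p => q ^+ cross_inv p.1 p.2 * H (size p.1) (size p.2))); last first.
  move=> p /splitsP[/mem_subseq s1 /mem_subseq s2 _].
  have p1_lt : all (fun y => y < x)%N p.1 by apply/allP => y /s1 /(allP s_lt).
  have p2_lt : all (fun y => y < x)%N p.2 by apply/allP => y /s2 /(allP s_lt).
  by rewrite cross_inv_consl // cross_inv_consr // /H exprD; ring.
rewrite {}IHs ?(path_sorted s_gt) //; set n := size s.
rewrite qpochS -mulrA; congr (_ * _).
rewrite /H (eq_bigr _ (fun (k : 'I_n.+1) _ => mulrDl _ _ _)).
rewrite big_split /= mulr_sumr.
(* With k + l = n + 1, the first part cancels a factor of (q;q)_k and the second
   one a factor of (q;q)_l; they vanish for k = 0 and l = 0 respectively. *)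
have split1q (k : 'I_n.+2) : 1 - q ^+ n.+1 =
    q ^+ (n.+1 - k) * (1 - q ^+ k) + (1 - q ^+ (n.+1 - k)).
  by rewrite mulrBr mulr1 -exprD subnK ?leq_ord //; ring.
under [RHS]eq_bigr => k _ do rewrite (split1q k) mulrDl.
rewrite big_split /=; congr (_ + _).
  rewrite [RHS]big_ord_recl expr0 subrr mulr0 mul0r add0r; apply: eq_bigr => k _.
  rewrite lift0 subSS qpochS; have := q_reg k; have := q_reg (n - k).
  by have := subr_qX_neq0 q_reg k; move=> *; field; rewrite -?andbA; apply/and3P.
rewrite [RHS]big_ord_recr /= subnn expr0 subrr mul0r addr0; apply: eq_bigr => k _.
rewrite subSn ?leq_ord // qpochS; have := q_reg k; have := q_reg (n - k).
by have := subr_qX_neq0 q_reg (n - k); move=> *; field; rewrite -?andbA; apply/and3P.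
Qed.

(** The statement for all r at once is needed, as the recursion for r involves
    the sums for r = 1. *)
Lemma sum_weight_permutations n r s : sorted gtn s -> size s = n ->
  \sum_(w <- permutations s) weight t q r w = qr_eulerian t r q n.
Proof.
elim/ltn_ind: n r s => -[_ r [|//] _ _|m IHm r [//|x s] s_gt [sz_s]].
  by rewrite /= big_seq1 weight_nil /qr_eulerian qpoch0 qr_eulerian_gf0 // mulr1.
have gtn_trans : transitive gtn by move=> a b c; rewrite /gtn /=; lia.
have s_lt : all (fun y => y < x)%N s by apply: order_path_min s_gt => a b c; lia.
have s_sorted := path_sorted s_gt.
have uxs : uniq (x :: s) by apply: (sorted_uniq gtn_trans) => // a; rewrite /gtn /= ltnn.
pose c r k := qr_eulerian t r q k.
pose G k l := (if l == 0%N then r else t * q ^+ ((0 < k) * l)) *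
  (c (if l == 0%N then r else 1) k * c (if k == 0%N then 1 else r) l).
rewrite (perm_big _ (perm_permutations_max uxs)) big_allpairs_dep /=.
rewrite (eq_big_seq (fun p => q ^+ cross_inv p.1 p.2 * G (size p.1) (size p.2))); last first.
  move=> p /splitsP[s1 s2 /perm_size]; rewrite size_cat sz_s => sz_p.
  have p1_lt : all (fun y => y < x)%N p.1.
    by apply/allP => y /(mem_subseq s1) /(allP s_lt).
  have p2_lt : all (fun y => y < x)%N p.2.
    by apply/allP => y /(mem_subseq s2) /(allP s_lt).
  rewrite big_allpairs /G /c -(IHm _ _ _ p.1) ?(subseq_sorted gtn_trans s1) //; last lia.
  rewrite -(IHm _ _ _ p.2) ?(subseq_sorted gtn_trans s2) //; last lia.
  rewrite big_distrlr /= mulrA mulr_sumr; apply: eq_big_seq => u.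
  rewrite mem_permutations mulr_sumr => pu; apply: eq_big_seq => v.
  rewrite mem_permutations => pv; rewrite weight_max_split; last 2 first.
  - by rewrite (perm_all _ pu).
  - by rewrite (perm_all _ pv).
  by rewrite (perm_size pu) (perm_size pv) (perm_cross_inv pu pv).
rewrite sum_splits // sz_s /qr_eulerian qpochS -mulrA; congr (_ * _).
rewrite qr_eulerian_gf_rec //.
pose e (k : nat) := (if (m - k == 0)%N then r else t * q ^+ ((0 < k) * (m - k)))%R *
  (qr_eulerian_gf t (if (m - k == 0)%N then r else 1) q k *
   qr_eulerian_gf t (if (k == 0)%N then 1 else r) q (m - k)%N).
rewrite (eq_bigr (fun k : 'I_m.+1 => e k)); last first.
  move=> k _; rewrite /G /c /qr_eulerian /e; have := q_reg k; have := q_reg (m - k).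
  by move=> *; field; apply/andP.
have gf0 r' : qr_eulerian_gf t r' q 0%N = 1 by apply: qr_eulerian_gf0.
rewrite big_ord_recr /= [e m]/e subnn eqxx. rewrite gf0 mulr1 addrC; congr (_ + _).
(* The term k = 0, where u is empty, matches the last term of the recursion:
   both contain the sum for r = 1 over words of length m. *)
case: m @e {IHm sz_s} => [|m] e; first by rewrite big_ord0 big_geq ?mulr0.
rewrite big_ord_recl big_nat_recr //= subnn gf0 !mulr1 addrC mulrDr; congr (_ + _).
  rewrite big_add1 big_mkord mulr_sumr; apply: eq_bigr => k _.
  by rewrite /e /bump add1n subSS subn_eq0 leqNgt ltn_ord mul1n /=; ring.
by rewrite /e subn0 /= gf0 expr0 mulr1 mul1r.
Qed.
End Weights.

Theorem theorem8 (n : nat) (hn : (1 <= n)%N) :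
  qr_eulerian Xt Xr Xq n =
  \sum_(pi : 'S_n) Xt ^+ des (word pi) * Xr ^+ rix (word pi) * Xq ^+ ai (word pi).
Proof.
have Xt1 : Xt != 1 by rewrite -[Xt]expr1 Xvar_expn_neq1.
have rev_gt : sorted gtn (rev (iota 1 n)) by rewrite rev_sorted iota_ltn_sorted.
have rev_size : size (rev (iota 1 n)) = n by rewrite size_rev size_iota.
rewrite -(sum_weight_permutations Xt1 qpoch_Xq_neq0 Xr rev_gt rev_size).
by rewrite -(perm_big _ (perm_word_permutations n)) big_map big_enum.
Qed.
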